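(* Let $Q\subseteq\mathbb{R}^{n}$ be a compact metric space and consider the system of linear equations $$A(x)\phi(x)=\gamma(x),\quad x\in Q,$$ where the entries of $A(x)=(a_{ij}(x_1,\ldots,x_n))\in M_{r,s}(\mathbb{R})$ and $\gamma(x)=(\gamma_i(x))\in\mathbb{R}^r$ are semialgebraic functions on $\mathbb{R}^n$. Let $H^{(0)}_x$ ($x\in Q$) be the fibers of the associated singular affine bundle and $\widetilde{\mathcal H}^{\mathrm{Gl}}=(\widetilde H^{\mathrm{Gl}}_x)_{x\in Q}$ the associated semialgebraic Glaeser-stable bundle. Assume that for every $x\in Q$ such that $\widetilde H^{\mathrm{Gl}}_x\neq\emptyset$ there exist $v_x\in\widetilde H^{\mathrm{Gl}}_x$ and a radius $r_{v_x}>0$ as in the definition of $\widetilde H_x^{\mathrm{Gl}}$ (so that $B(x,r_{v_x})\ni y\mapsto \gamma_{v_x}(y)=\Pi_{H^{(0)}_y}v_x$ is semialgebraic) such that $B(x,r_{v_x})\ni y\mapsto\gamma_{v_x}(y)=\Pi_{H^{(0)}_y}v_x$ is discontinuous at most at isolated points (which therefore must be finitely many). Then the system has a continuous semialgebraic solution $\phi:Q\to\mathbb{R}^s$ if and only if $\widetilde{\mathcal H}^{\mathrm{Gl}}$ has no empty fiber, i.e. $\widetilde H^{\mathrm{Gl}}_x\neq\emptyset$ for all $x\in Q$.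
   Context: $M_{r,s}(\mathbb{R})$ is the set of real $r\times s$ matrices; all $\mathbb{R}^m$ carry the Euclidean norm, $Q$ carries the Euclidean metric, and $B(x,r)$ denotes the Euclidean ball in $Q$, $B(x,r)=\{y\in Q:\|y-x\|<r\}$. A function is semialgebraic if its graph is a semialgebraic set. A solution of the system is a map $\phi:Q\to\mathbb{R}^s$ with $A(x)\phi(x)=\gamma(x)$ for all $x\in Q$ (no regularity required unless stated). For a (nonempty) affine subspace $V\subseteq\mathbb{R}^s$ and $w\in\mathbb{R}^s$, $\Pi_V w$ is the point of $V$ closest to $w$ in Euclidean norm. The empty set and $\mathbb{R}^s$ are allowed as affine subspaces of $\mathbb{R}^s$. A singular affine bundle (bundle) is a family $\mathcal H=(H_x)_{x\in Q}$ of affine subspaces $H_x\subseteq\mathbb{R}^s$, called fibers. The bundle associated with the system is $\mathcal H=\mathcal H^{(0)}$ with fibers $H_x=H^{(0)}_x=\{\lambda\in\mathbb{R}^s: A(x)\lambda=\gamma(x)\}$. The Glaeser refinement of a bundle $(H_x)_{x\in Q}$ is the bundle with fibers $\{v\in H_x:\ \mathrm{dist}(v,H_y)\to 0 \text{ as } y\to x,\ y\in Q\}$ (with $\mathrm{dist}(v,\emptyset)=+\infty$). $\mathcal H^{(k+1)}$ is the Glaeser refinement of $\mathcal H^{(k)}$; this sequence stabilizes after finitely many steps, and the stable bundle is the Glaeser-stable refinement $\mathcal H^{\mathrm{Gl}}=(H^{\mathrm{Gl}}_x)_{x\in Q}$. The semialgebraic Glaeser-stable bundle associated with the system is $\widetilde{\mathcal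 H}^{\mathrm{Gl}}=(\widetilde H^{\mathrm{Gl}}_x)_{x\in Q}$, where $$\widetilde H^{\mathrm{Gl}}_x=\{v\in H^{\mathrm{Gl}}_x:\ \exists\, r_v>0 \text{ such that } B(x,r_v)\ni y\mapsto\gamma_v(y)=\Pi_{H^{(0)}_y}v \text{ is semialgebraic}\}$$ (in particular $H_y^{(0)}\ne\emptyset$ for $y\in B(x,r_v)$). ''Discontinuous at most at isolated points'' means that every point of the set of discontinuities is an isolated point of that set. *)

(* Defs.v *)
(* MathComp-Analysis, over an arbitrary R : realType.  The space R^m is
   'cV[R]_m.  Its library topology is the product topology, which coincides with
   the one of the Euclidean norm, so that compactness, continuity and limits are
   the library notions; wherever the metric itself matters (balls, distances,
   nearest points) the Euclidean norm below is used, since the library norm on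
   matrices is the sup norm. *)
From HB Require Import structures.
From mathcomp Require Import all_boot all_order all_algebra.
From mathcomp Require Import all_classical all_reals all_analysis.
From mathcomp Require mpoly.

Set Implicit Arguments.
Unset Strict Implicit.
Unset Printing Implicit Defensive.

Import Order.TTheory GRing.Theory Num.Theory.
Import numFieldNormedType.Exports.

Local Open Scope classical_set_scope.
Local Open Scope ring_scope.

Definition enorm (R : realType) (m : nat) (x : 'cV[R]_m) : R :=
  Num.sqrt (\sum_(i < m) x i 0 ^+ 2).

(* The ball in the metric space Q, not in R^n. *)
Definition eball (R : realType) (n : nat) (Q : set 'cV[R]_n)
    (x : 'cV[R]_n) (r : R) : set 'cV[R]_n :=
  [set y | Q y /\ enorm (y - x) < r].

(* Takes the value +oo when V is empty. *)
Definition edist_set (R : realType) (m : nat) (v : 'cV[R]_m)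
    (V : set 'cV[R]_m) : \bar R :=
  ereal_inf [set (enorm (v - w))%:E | w in V].

(* The point of V nearest to w; meaningful for V nonempty and affine. *)
Definition eproj (R : realType) (m : nat) (V : set 'cV[R]_m) (w : 'cV[R]_m) :
    'cV[R]_m :=
  xget 0 [set u | V u /\ forall u', V u' -> enorm (u - w) <= enorm (u' - w)].

(* The Boolean algebra of sets generated by the sets {p > 0}, i.e. the sets
   given by finite Boolean combinations of polynomial equations and
   inequalities: {p = 0} is the complement of {p > 0} `|` {- p > 0}. *)
Inductive semialgebraic (R : realType) (m : nat) : set 'cV[R]_m -> Prop :=
| semialgebraic_pos (p : mpoly.mpoly m R) :
    semialgebraic [set x | 0 < mpoly.meval (fun i => x i 0) p]
| semialgebraic_setC (S : set 'cV[R]_m) :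
    semialgebraic S -> semialgebraic (~` S)
| semialgebraic_setU (S T : set 'cV[R]_m) :
    semialgebraic S -> semialgebraic T -> semialgebraic (S `|` T).

Definition semialgebraic_on (R : realType) (n m : nat) (D : set 'cV[R]_n)
    (f : 'cV[R]_n -> 'cV[R]_m) : Prop :=
  semialgebraic [set col_mx x (f x) | x in D].

Definition semialgebraic_rfun (R : realType) (n : nat) (f : 'cV[R]_n -> R) :
    Prop :=
  semialgebraic_on setT (fun x => const_mx (f x) : 'cV[R]_1).

(* Only the fibers over points of Q are relevant.  The bundles used below have
   affine fibers: solution sets of linear systems and, inductively, their Glaeser
   refinements. *)
Definition bundle (R : realType) (n s : nat) := 'cV[R]_n -> set 'cV[R]_s.

Definition system_bundle (R : realType) (n r s : nat)
    (A : 'cV[R]_n -> 'M[R]_(r, s)) (gamma : 'cV[R]_n -> 'cV[R]_r) :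
    bundle R n s :=
  fun x => [set lambda | A x *m lambda = gamma x].

Definition glaeser_refinement (R : realType) (n s : nat) (Q : set 'cV[R]_n)
    (H : bundle R n s) : bundle R n s :=
  fun x => [set v | H x v /\
    edist_set v (H y) @[y --> within Q (nbhs x)] --> 0%E].

Definition glaeser_iter (R : realType) (n s : nat) (Q : set 'cV[R]_n)
    (H : bundle R n s) (k : nat) : bundle R n s :=
  iter k (glaeser_refinement Q) H.

(* H^(k) for an index k at which the sequence is stationary.  Any two such
   indices give the same bundle over Q, and one always exists, so the default
   index of xget plays no role. *)
Definition glaeser_stable (R : realType) (n s : nat) (Q : set 'cV[R]_n)
    (H : bundle R n s) : bundle R n s :=
  glaeser_iter Q H
    (xget 1%N [set k | forall x, Q x ->
                         glaeser_iter Q H k.+1 x = glaeser_iter Q H k x]).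

Definition gamma_proj (R : realType) (n r s : nat)
    (A : 'cV[R]_n -> 'M[R]_(r, s)) (gamma : 'cV[R]_n -> 'cV[R]_r)
    (v : 'cV[R]_s) : 'cV[R]_n -> 'cV[R]_s :=
  fun y => eproj (system_bundle A gamma y) v.

(* The nonemptiness clause is what makes gamma_proj well defined on the ball. *)
Definition semialgebraic_radius (R : realType) (n r s : nat) (Q : set 'cV[R]_n)
    (A : 'cV[R]_n -> 'M[R]_(r, s)) (gamma : 'cV[R]_n -> 'cV[R]_r)
    (x : 'cV[R]_n) (v : 'cV[R]_s) (rho : R) : Prop :=
  [/\ 0 < rho,
      forall y, eball Q x rho y -> system_bundle A gamma y !=set0 &
      semialgebraic_on (eball Q x rho) (gamma_proj A gamma v)].

Definition semialgebraic_glaeser_stable (R : realType) (n r s : nat)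
    (Q : set 'cV[R]_n) (A : 'cV[R]_n -> 'M[R]_(r, s))
    (gamma : 'cV[R]_n -> 'cV[R]_r) : bundle R n s :=
  fun x => [set v | glaeser_stable Q (system_bundle A gamma) x v /\
    exists rho : R, semialgebraic_radius Q A gamma x v rho].

Definition discontinuities (R : realType) (n m : nat) (D : set 'cV[R]_n)
    (f : 'cV[R]_n -> 'cV[R]_m) : set 'cV[R]_n :=
  [set y | D y /\ ~ (f z @[z --> within D (nbhs y)] --> f y)].

Definition isolated_discontinuities (R : realType) (n m : nat)
    (D : set 'cV[R]_n) (f : 'cV[R]_n -> 'cV[R]_m) : Prop :=
  discontinuities D f `<=` isolated (discontinuities D f).

(* Main.v *)
(* If [phi] is a continuous semialgebraic solution, then [phi x] survives every
   Glaeser refinement at [x], and the nearest-point map [y |-> gamma_v y] with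
   [v = phi x] is first-order definable from [A], [gamma] and the domain of [phi],
   hence semialgebraic by Tarski-Seidenberg.

   Conversely, let [v] be the vector given at [x].  The map [gamma_v] is
   continuous at [x], because the distance from [v] to the fibers tends to [0].
   Its discontinuities form a semialgebraic set consisting of isolated points,
   hence a countable one.  The distances from [x] to these points then form a
   countable semialgebraic subset of the line, which misses some interval
   ]0, e[; so [gamma_v] is continuous on a small ball around [x].  Finitely many
   such balls cover [Q], and the solutions [gamma_v] are glued by a semialgebraic
   partition of unity, a convex combination of solutions being a solution. *)
Require Import Defs.
From mathcomp Require Import all_boot all_order all_algebra finmap.
From mathcomp Require Import all_classical all_reals all_analysis.
From mathcomp Require mpoly ordered_qelim qe_rcf polyrcf.
Import (canonicals) mpoly.
Import Order.TTheory GRing.Theory Num.Theory.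
Import numFieldNormedType.Exports.
Local Open Scope classical_set_scope.
Local Open Scope ring_scope.

Set Implicit Arguments.
Unset Strict Implicit.
Unset Printing Implicit Defensive.

(** * Semialgebraic sets and quantifier elimination *)

Module ord := ordered_qelim.ord.

(** Formulas are evaluated in environments that are lists, whereas points are columns. *)
Definition coords (R : realType) (m : nat) (x : 'cV[R]_m) : seq R :=
  [seq x i 0 | i <- enum 'I_m].

Lemma size_coords (R : realType) (m : nat) (x : 'cV[R]_m) :
  size (coords x) = m.
Proof. by rewrite size_map size_enum_ord. Qed.

Lemma nth_coords (R : realType) (m : nat) (x : 'cV[R]_m) (i : 'I_m) :
  (coords x)`_i = x i 0.
Proof. by rewrite (nth_map i) ?size_enum_ord// nth_ord_enum. Qed.

Lemma coords_col_mx (R : realType) (m k : nat) (x : 'cV[R]_m) (y : 'cV[R]_k) :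
  coords (col_mx x y) = coords x ++ coords y.
Proof.
apply: (@eq_from_nth _ 0) => [|i]; first by rewrite size_cat !size_coords.
rewrite size_coords => im; have -> : i = Ordinal im by [].
rewrite nth_coords nth_cat size_coords mxE.
by case: splitP => j /= ->; rewrite ?addKn nth_coords.
Qed.

Lemma coords_surj (R : realType) (m : nat) (s : seq R) :
  size s = m -> coords (\col_(i < m) s`_i) = s.
Proof.
move=> sm; apply: (@eq_from_nth _ 0) => [|i]; first by rewrite size_coords.
by rewrite size_coords => im; rewrite -[i]/(val (Ordinal im)) nth_coords mxE.
Qed.

(** Expand [p] into monomials: finite sums and products of functions given by terms are again given
    by terms. *)
Lemma mpoly_term (R : realType) (m : nat) (p : mpoly.mpoly m R) :
  exists t : GRing.term R, forall e : seq R,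
    GRing.eval e t = mpoly.meval (fun i : 'I_m => e`_i) p.
Proof.
have sumT (I : Type) (l : seq I) (g : I -> seq R -> R) :
    (forall i, exists t, forall e, GRing.eval e t = g i e) ->
    exists t, forall e, GRing.eval e t = \sum_(i <- l) g i e.
  move=> gT; elim: l => [|i l [t IH]].
    by exists (GRing.NatConst R 0) => e; rewrite big_nil.
  by have [u gi] := gT i; exists (GRing.Add u t) => e; rewrite big_cons /= gi IH.
have prodT (I : Type) (l : seq I) (g : I -> seq R -> R) :
    (forall i, exists t, forall e, GRing.eval e t = g i e) ->
    exists t, forall e, GRing.eval e t = \prod_(i <- l) g i e.
  move=> gT; elim: l => [|i l [t IH]].
    by exists (GRing.NatConst R 1) => e; rewrite big_nil.
  by have [u gi] := gT i; exists (GRing.Mul u t) => e; rewrite big_cons /= gi IH.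
have [|t tE] := sumT _ (mpoly.msupp p) (fun d e =>
    mpoly.mcoeff d p * \prod_(i < m) e`_i ^+ mpoly.fun_of_multinom d i).
  move=> d; have [|t tE] := prodT _ (index_enum 'I_m) (fun i e =>
      e`_i ^+ mpoly.fun_of_multinom d i).
    by move=> i; exists (GRing.Exp (GRing.Var R i) (mpoly.fun_of_multinom d i)).
  by exists (GRing.Mul (GRing.Const (mpoly.mcoeff d p)) t) => e; rewrite /= tE.
by exists t => e; rewrite tE mpoly.mevalE.
Qed.

(** A predicate on functions, so that polynomiality of an expression can be proved by following its
    syntax. *)
Definition polynomial_fun (R : realType) (m : nat) (f : 'cV[R]_m -> R) : Prop :=
  exists p : mpoly.mpoly m R, forall x, f x = mpoly.meval (fun i => x i 0) p.

Definition polynomial_map (R : realType) (m k : nat)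
    (f : 'cV[R]_m -> 'cV[R]_k) : Prop :=
  forall i, polynomial_fun (fun x => f x i 0).

Lemma polynomial_fun_coord (R : realType) (m k : nat)
    (f : 'cV[R]_m -> 'cV[R]_k) i :
  polynomial_map f -> polynomial_fun (fun x => f x i 0).
Proof. exact. Qed.

Lemma polynomial_fun_cst (R : realType) (m : nat) (c : R) :
  polynomial_fun (fun _ : 'cV[R]_m => c).
Proof. by exists (mpoly.mpolyC m c) => x; rewrite mpoly.mevalC. Qed.

Lemma polynomial_funD (R : realType) (m : nat) (f g : 'cV[R]_m -> R) :
  polynomial_fun f -> polynomial_fun g -> polynomial_fun (fun x => f x + g x).
Proof.
by move=> [p fE] [q gE]; exists (p + q) => x; rewrite fE gE mpoly.mevalD.
Qed.

Lemma polynomial_funN (R : realType) (m : nat) (f : 'cV[R]_m -> R) :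
  polynomial_fun f -> polynomial_fun (fun x => - f x).
Proof. by move=> [p fE]; exists (- p) => x; rewrite fE mpoly.mevalN. Qed.

Lemma polynomial_funM (R : realType) (m : nat) (f g : 'cV[R]_m -> R) :
  polynomial_fun f -> polynomial_fun g -> polynomial_fun (fun x => f x * g x).
Proof.
by move=> [p fE] [q gE]; exists (p * q) => x; rewrite fE gE mpoly.mevalM.
Qed.

Lemma polynomial_funX (R : realType) (m k : nat) (f : 'cV[R]_m -> R) :
  polynomial_fun f -> polynomial_fun (fun x => f x ^+ k).
Proof.
move=> fP; elim: k => [|k IH]; first exact: polynomial_fun_cst.
under eq_fun do rewrite exprS; exact: polynomial_funM.
Qed.

Lemma polynomial_fun_sum (R : realType) (m : nat) (I : Type) (l : seq I)
    (f : I -> 'cV[R]_m -> R) :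
  (forall i, polynomial_fun (f i)) ->
  polynomial_fun (fun x => \sum_(i <- l) f i x).
Proof.
move=> fP; elim: l => [|i l IH].
  under eq_fun do rewrite big_nil; exact: polynomial_fun_cst.
under eq_fun do rewrite big_cons; exact: polynomial_funD.
Qed.

Lemma polynomial_map_id (R : realType) (m : nat) :
  polynomial_map (fun x : 'cV[R]_m => x).
Proof.
move=> i; exists (mpoly.mpolyX R (mpoly.mnm1 i)) => x.
by rewrite mpoly.mevalXU.
Qed.

Lemma polynomial_map_usubmx (R : realType) (m k l : nat)
    (f : 'cV[R]_m -> 'cV[R]_(k + l)) :
  polynomial_map f -> polynomial_map (fun x => usubmx (f x)).
Proof.
move=> fP i; have := fP (lshift l i).
by under [in X in _ -> X]eq_fun do rewrite mxE.
Qed.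

Lemma polynomial_map_dsubmx (R : realType) (m k l : nat)
    (f : 'cV[R]_m -> 'cV[R]_(k + l)) :
  polynomial_map f -> polynomial_map (fun x => dsubmx (f x)).
Proof.
move=> fP i; have := fP (rshift k i).
by under [in X in _ -> X]eq_fun do rewrite mxE.
Qed.

Lemma polynomial_map_col_mx (R : realType) (m k l : nat)
    (f : 'cV[R]_m -> 'cV[R]_k) (g : 'cV[R]_m -> 'cV[R]_l) :
  polynomial_map f -> polynomial_map g ->
  polynomial_map (fun x => col_mx (f x) (g x)).
Proof.
move=> fP gP i; under eq_fun do rewrite mxE.
by case: (fintype.split i) => j; [exact: fP|exact: gP].
Qed.

Lemma polynomial_map_cst (R : realType) (m k : nat) (c : 'cV[R]_k) :
  polynomial_map (fun _ : 'cV[R]_m => c).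
Proof. by move=> i; exact: polynomial_fun_cst. Qed.

Lemma polynomial_mapB (R : realType) (m k : nat) (f g : 'cV[R]_m -> 'cV[R]_k) :
  polynomial_map f -> polynomial_map g -> polynomial_map (fun x => f x - g x).
Proof.
move=> fP gP i; under eq_fun do rewrite !mxE.
by apply: polynomial_funD (fP i) (polynomial_funN (gP i)).
Qed.

Lemma polynomial_mapZ (R : realType) (m k : nat) (f : 'cV[R]_m -> R)
    (g : 'cV[R]_m -> 'cV[R]_k) :
  polynomial_fun f -> polynomial_map g -> polynomial_map (fun x => f x *: g x).
Proof.
by move=> fP gP i; under eq_fun do rewrite !mxE; exact: polynomial_funM.
Qed.

(** [rterm] excludes inverses, and all other term constructors preserve polynomiality. *)
Lemma rterm_polynomial (R : realType) (m : nat) (t : GRing.term R) :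
  GRing.rterm t ->
  polynomial_fun (fun x : 'cV[R]_m => GRing.eval (coords x) t).
Proof.
elim: t => //=.
- move=> i _; have [im|mi] := ltnP i m.
    have := @polynomial_map_id R m (Ordinal im).
    by under [in X in X -> _]eq_fun do rewrite -nth_coords.
  (* A variable of index at least [m] reads the default value 0. *)
  by under eq_fun do rewrite nth_default ?size_coords//; exact: polynomial_fun_cst.
- by move=> *; exact: polynomial_fun_cst.
- by move=> *; exact: polynomial_fun_cst.
- by move=> t IHt u IHu /andP[/IHt tP /IHu uP]; exact: polynomial_funD.
- by move=> t IHt /IHt tP; exact: polynomial_funN.
- move=> t IHt k /IHt tP; under eq_fun do rewrite -mulr_natr.
  by apply: polynomial_funM tP (polynomial_fun_cst _ _).
- by move=> t IHt u IHu /andP[/IHt tP /IHu uP]; exact: polynomial_funM.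
- by move=> t IHt k /IHt tP; exact: polynomial_funX.
Qed.

Lemma semialgebraic_ext (R : realType) (m : nat) (S T : set 'cV[R]_m) :
  (forall x, S x <-> T x) -> semialgebraic S -> semialgebraic T.
Proof. by move=> ST; have -> : S = T by apply/funext => x; exact/propext. Qed.

Lemma semialgebraic_not (R : realType) (m : nat) (P : 'cV[R]_m -> Prop) :
  semialgebraic P -> semialgebraic (fun x => ~ P x).
Proof. exact: semialgebraic_setC. Qed.

Lemma semialgebraic_or (R : realType) (m : nat) (P Q : 'cV[R]_m -> Prop) :
  semialgebraic P -> semialgebraic Q -> semialgebraic (fun x => P x \/ Q x).
Proof. exact: semialgebraic_setU. Qed.

Lemma semialgebraic_and (R : realType) (m : nat) (P Q : 'cV[R]_m -> Prop) :
  semialgebraic P -> semialgebraic Q -> semialgebraic (fun x => P x /\ Q x).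
Proof.
move=> /semialgebraic_not sP /semialgebraic_not sQ.
apply: semialgebraic_ext (semialgebraic_not (semialgebraic_or sP sQ)) => x.
by rewrite not_orE !notE.
Qed.

Lemma semialgebraic_imply (R : realType) (m : nat) (P Q : 'cV[R]_m -> Prop) :
  semialgebraic P -> semialgebraic Q -> semialgebraic (fun x => P x -> Q x).
Proof.
move=> /semialgebraic_not sP sQ.
by apply: semialgebraic_ext (semialgebraic_or sP sQ) => x; rewrite implyE.
Qed.

Lemma semialgebraic_lt (R : realType) (m : nat) (f g : 'cV[R]_m -> R) :
  polynomial_fun f -> polynomial_fun g -> semialgebraic (fun x => f x < g x).
Proof.
move=> fP gP; have [p pE] := polynomial_funD gP (polynomial_funN fP).
apply: semialgebraic_ext (semialgebraic_pos p) => x /=.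
by rewrite -pE subr_gt0.
Qed.

Lemma semialgebraic_le (R : realType) (m : nat) (f g : 'cV[R]_m -> R) :
  polynomial_fun f -> polynomial_fun g -> semialgebraic (fun x => f x <= g x).
Proof.
move=> fP gP.
apply: semialgebraic_ext (semialgebraic_not (semialgebraic_lt gP fP)) => x.
by rewrite leNgt; split => /negP.
Qed.

Lemma semialgebraic_eq (R : realType) (m : nat) (f g : 'cV[R]_m -> R) :
  polynomial_fun f -> polynomial_fun g -> semialgebraic (fun x => f x = g x).
Proof.
move=> fP gP.
apply: semialgebraic_ext
  (semialgebraic_and (semialgebraic_le fP gP) (semialgebraic_le gP fP)) => x.
by split=> [[fg gf]|->//]; apply/le_anti/andP.
Qed.

Lemma semialgebraic_cst (R : realType) (m : nat) (P : Prop) :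
  semialgebraic (fun _ : 'cV[R]_m => P).
Proof.
have [p|np] := pselect P.
  apply: semialgebraic_ext (semialgebraic_eq (polynomial_fun_cst m (0 : R))
    (polynomial_fun_cst m 0)) => x; tauto.
apply: semialgebraic_ext (semialgebraic_lt (polynomial_fun_cst m (0 : R))
  (polynomial_fun_cst m 0)) => x.
by rewrite ltxx.
Qed.

Lemma semialgebraic_all (R : realType) (m : nat) (I : finType)
    (P : I -> 'cV[R]_m -> Prop) :
  (forall i, semialgebraic (P i)) -> semialgebraic (fun x => forall i, P i x).
Proof.
move=> sP; suff /(_ (enum I)) : forall l : seq I,
    semialgebraic (fun x => forall i, i \in l -> P i x).
  by apply: semialgebraic_ext => x; split=> [Px i|Px i _]; apply: Px; rewrite mem_enum.
elim=> [|i l IH].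
  by apply: semialgebraic_ext (@semialgebraic_cst R m True) => x; split.
apply: semialgebraic_ext (semialgebraic_and (sP i) IH) => x; split.
  by move=> [Pi Pl] j; rewrite inE => /orP[/eqP->//|]; exact: Pl.
move=> Px; split=> [|j jl]; apply: Px; rewrite inE ?eqxx//.
by rewrite jl orbT.
Qed.

Lemma semialgebraic_eqmap (R : realType) (m k : nat)
    (f g : 'cV[R]_m -> 'cV[R]_k) :
  polynomial_map f -> polynomial_map g -> semialgebraic (fun x => f x = g x).
Proof.
move=> fP gP; have := @semialgebraic_all _ _ _ (fun i x => f x i 0 = g x i 0)
  (fun i => semialgebraic_eq (fP i) (gP i)).
apply: semialgebraic_ext => x; split=> [fg|->//].
by apply/colP => i; exact: fg.
Qed.

(** Preimages commute with Boolean operations, so only the generators matter; there [f] is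
    substituted into the monomial expansion of [p]. *)
Lemma semialgebraic_preimage (R : realType) (m k : nat)
    (f : 'cV[R]_m -> 'cV[R]_k) (S : set 'cV[R]_k) :
  polynomial_map f -> semialgebraic S -> semialgebraic (fun x => S (f x)).
Proof.
move=> fP; elim=> [p|T _ /semialgebraic_not//|T U _ sT _ sU]; last first.
  exact: semialgebraic_or.
apply: semialgebraic_lt; first exact: polynomial_fun_cst.
under eq_fun do rewrite mpoly.mevalE.
apply: polynomial_fun_sum => d.
apply: polynomial_funM; first exact: polynomial_fun_cst.
elim: (index_enum _) => [|i l IH].
  by under eq_fun do rewrite big_nil; exact: polynomial_fun_cst.
under eq_fun do rewrite big_cons.
by apply: polynomial_funM => //; exact: polynomial_funX.
Qed.

Lemma semialgebraic_formula (R : realType) (m : nat) (S : set 'cV[R]_m) :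
  semialgebraic S ->
  exists f : ord.formula R, forall x, S x <-> ord.holds (coords x) f.
Proof.
elim=> [p|T _ [f fE]|T U _ [f fE] _ [g gE]].
- have [t tE] := mpoly_term p.
  exists (ord.Lt (GRing.NatConst R 0) t) => x /=; rewrite tE.
  by under [X in _ <-> is_true (_ < X)]mpoly.meval_eq do rewrite nth_coords.
- by exists (ord.Not f) => x; split=> nT /fE.
- by exists (ord.Or f g) => x; split=> -[/fE|/gE]; [left|right|left|right].
Qed.

(** [to_rform] removes inverses and quantifier elimination over the real closed field [R] removes
    quantifiers. What is left is a Boolean combination of comparisons of polynomials. *)
Lemma formula_semialgebraic (R : realType) (m : nat) (f : ord.formula R) :
  semialgebraic (fun x : 'cV[R]_m => ord.holds (coords x) f).
Proof.
pose qf := ord.quantifier_elim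
  (fun i bc => qe_rcf.qfr_to_formula (qe_rcf.wproj i bc)) (ord.to_rform f).
have /andP[] := ord.quantifier_elim_wf (@qe_rcf.wf_QE_wproj R)
  (ord.to_rform_rformula f).
rewrite -/qf => qfF rF.
have : semialgebraic (fun x : 'cV[R]_m => ord.qf_eval (coords x) qf).
  elim: {f} qf qfF rF => //=.
  - by move=> b _ _; exact: semialgebraic_cst.
  - move=> t u _ /andP[tR uR].
    apply: semialgebraic_ext (semialgebraic_eq (rterm_polynomial m tR)
      (rterm_polynomial m uR)) => x.
    by split=> /eqP.
  - by move=> t u _ /andP[tR uR]; apply: semialgebraic_lt;
      exact: rterm_polynomial.
  - by move=> t u _ /andP[tR uR]; apply: semialgebraic_le;
      exact: rterm_polynomial.
  - move=> f IHf g IHg /andP[qf qg] /andP[rf rg].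
    apply: semialgebraic_ext (semialgebraic_and (IHf qf rf) (IHg qg rg)) => x.
    by split=> /andP.
  - move=> f IHf g IHg /andP[qf qg] /andP[rf rg].
    apply: semialgebraic_ext (semialgebraic_or (IHf qf rf) (IHg qg rg)) => x.
    by split=> /orP.
  - move=> f IHf g IHg /andP[qf qg] /andP[rf rg].
    apply: semialgebraic_ext (semialgebraic_imply (IHf qf rf) (IHg qg rg)) => x.
    by split=> /implyP.
  - move=> f IHf qf rf.
    by apply: semialgebraic_ext (semialgebraic_not (IHf qf rf)) => x; split=> /negP.
apply: semialgebraic_ext => x.
have qfP := ord.quantifier_elim_rformP (@qe_rcf.wf_QE_wproj R)
  (@qe_rcf.valid_QE_wproj R) (coords x) (ord.to_rform_rformula f).
by split=> [/qfP/ord.to_rformP//|/ord.to_rformP/qfP].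
Qed.

(** Assigning the variable just past the end of [e] appends its value to [e], so the block is filled
    one variable at a time. *)
Lemma holds_exists_block (R : realType) (k : nat) (e : seq R)
    (f : ord.formula R) :
  ord.holds e (foldr (@ord.Exists R) f (iota (size e) k)) <->
  exists2 s, size s = k & ord.holds (e ++ s) f.
Proof.
elim: k e => [|k IH] e /=.
  split=> [ef|[s /size0nil->]]; last by rewrite cats0.
  by exists [::]; rewrite ?cats0.
have rE x : set_nth 0 e (size e) x = rcons e x.
  by elim: e {IH} => //= y e ->.
split=> [[x]|[[//|x s] [sk]] efs].
  rewrite rE -(size_rcons e x) => /IH[s sk efs].
  by exists (x :: s); rewrite /= ?sk// -cat_rcons.
exists x; rewrite rE -(size_rcons e x); apply/IH.
by exists s => //; rewrite cat_rcons.
Qed.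

(* Tarski-Seidenberg: the quantified block is eliminated by [qe_rcf]. *)
Lemma semialgebraic_exists (R : realType) (m k : nat)
    (P : 'cV[R]_m -> 'cV[R]_k -> Prop) :
  semialgebraic (fun z : 'cV[R]_(m + k) => P (usubmx z) (dsubmx z)) ->
  semialgebraic (fun x => exists y, P x y).
Proof.
move=> /semialgebraic_formula[f fE].
(* The variables [m], ..., [m + k - 1] are the coordinates of [y] in [col_mx x y]. *)
have := formula_semialgebraic m (foldr (@ord.Exists R) f (iota m k)).
apply: semialgebraic_ext => x; rewrite -[in iota m k](size_coords x).
rewrite holds_exists_block; split=> [[s sk xsf]|[y Pxy]].
  exists (\col_i s`_i).
  have := fE (col_mx x (\col_i s`_i)); rewrite col_mxKu col_mxKd => ->.
  by rewrite coords_col_mx coords_surj.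
exists (coords y); first exact: size_coords.
by rewrite -coords_col_mx -fE col_mxKu col_mxKd.
Qed.

Lemma semialgebraic_forall (R : realType) (m k : nat)
    (P : 'cV[R]_m -> 'cV[R]_k -> Prop) :
  semialgebraic (fun z : 'cV[R]_(m + k) => P (usubmx z) (dsubmx z)) ->
  semialgebraic (fun x => forall y, P x y).
Proof.
move=> /semialgebraic_not/(@semialgebraic_exists _ _ _ (fun x y => ~ P x y)).
move=> /semialgebraic_not; apply: semialgebraic_ext => x.
split=> [nP y|Px [y]]; last by apply.
by apply: contrapT => nPxy; apply: nP; exists y.
Qed.

(** * The Euclidean norm and nearest points *)

Lemma sqr_enorm (R : realType) (m : nat) (z : 'cV[R]_m) :
  enorm z ^+ 2 = \sum_(i < m) z i 0 ^+ 2.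
Proof. by rewrite sqr_sqrtr// sumr_ge0// => i _; rewrite sqr_ge0. Qed.

Lemma enorm_ge0 (R : realType) (m : nat) (z : 'cV[R]_m) : 0 <= enorm z.
Proof. exact: sqrtr_ge0. Qed.

Lemma enorm0 (R : realType) (m : nat) : enorm (0 : 'cV[R]_m) = 0.
Proof. by rewrite /enorm big1 ?sqrtr0// => i _; rewrite mxE expr0n. Qed.

Lemma enormN (R : realType) (m : nat) (z : 'cV[R]_m) : enorm (- z) = enorm z.
Proof.
by congr Num.sqrt; apply: eq_bigr => i _; rewrite mxE sqrrN.
Qed.

Lemma enormB (R : realType) (m : nat) (y z : 'cV[R]_m) :
  enorm (y - z) = enorm (z - y).
Proof. by rewrite -enormN opprB. Qed.

Lemma coord_le_enorm (R : realType) (m : nat) (z : 'cV[R]_m) (i : 'I_m) :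
  `|z i 0| <= enorm z.
Proof.
rewrite -(ler_pXn2r (n := 2))// ?nnegrE ?enorm_ge0//.
rewrite sqr_enorm real_normK ?num_real//.
by rewrite (bigD1 i)//= lerDl sumr_ge0// => j _; rewrite sqr_ge0.
Qed.

Lemma enorm_eq0 (R : realType) (m : nat) (z : 'cV[R]_m) :
  enorm z = 0 -> z = 0.
Proof.
move=> z0; apply/colP => i; rewrite mxE; apply/eqP.
by rewrite -normr_le0 -z0 coord_le_enorm.
Qed.

(** A ball of the library is a product of finitely many coordinate balls. *)
Lemma cvg_colP (R : realType) (m : nat) (T : Type) (F : set_system T)
    (FF : Filter F) (f : T -> 'cV[R]_m) (l : 'cV[R]_m) :
  (f t @[t --> F] --> l) <-> forall i, f t i 0 @[t --> F] --> l i 0.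
Proof.
split=> [fl i|fl].
  exact: (@cvg_comp _ _ _ f (fun M : 'cV[R]_m => M i 0) _ _ _ fl
    (@coord_continuous R m 1 i 0 l)).
apply/cvg_ballP => e e0.
have /filter_forall : forall i, \forall t \near F, ball (l i 0) e (f t i 0).
  by move=> i; have /cvg_ballP/(_ e e0) := fl i.
by apply: filterS => t lt; split=> // i j; rewrite ord1.
Qed.

Lemma enorm_continuous (R : realType) (m : nat) : continuous (@enorm R m).
Proof.
move=> z.
have sumz : \sum_(i < m) y i 0 ^+ 2 @[y --> z] --> \sum_(i < m) z i 0 ^+ 2.
  apply: (@cvg_big _ _ _ _ _ _ _ (nbhs z) _ (fun i (y : 'cV[R]_m) => y i 0 ^+ 2)
    (fun i => z i 0 ^+ 2)); first exact: add_continuous.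
  by move=> i _; apply: (cvgM (@coord_continuous R m 1 i 0 z)
    (@coord_continuous R m 1 i 0 z)).
exact: (@cvg_comp _ _ _ (fun y : 'cV[R]_m => \sum_(i < m) y i 0 ^+ 2) Num.sqrt
  _ _ _ sumz (@sqrt_continuous R _)).
Qed.

Lemma enormB_continuous (R : realType) (m : nat) (x y : 'cV[R]_m) :
  enorm (z - x) @[z --> y] --> enorm (y - x).
Proof.
have yx : z - x @[z --> y] --> y - x.
  apply/(cvg_colP (nbhs_filter y)) => i; rewrite !mxE; under eq_fun do rewrite !mxE.
  exact: (cvgB (@coord_continuous R m 1 i 0 y) (cvg_cst _)).
exact: (@cvg_comp _ _ _ (fun z : 'cV[R]_m => z - x) (@enorm R m)
  _ _ _ yx (@enorm_continuous R m _)).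
Qed.

(** The Euclidean norm bounds each coordinate and is continuous for the library topology, so both
    give the same neighbourhoods. *)
Lemma nbhs_enormP (R : realType) (m : nat) (x : 'cV[R]_m) (U : set 'cV[R]_m) :
  nbhs x U <-> exists2 d : R, 0 < d & forall y, enorm (y - x) < d -> U y.
Proof.
split=> [/nbhs_ballP[d d0 dU]|[d d0 dU]].
  exists d => // y yx; apply: dU; split=> // i j; rewrite ord1.
  rewrite -ball_normE/= distrC; apply: le_lt_trans yx.
  by have := coord_le_enorm (y - x) i; rewrite !mxE.
have := @enormB_continuous _ _ x x; rewrite subrr enorm0 => /cvgr_lt/(_ d d0).
exact: filterS.
Qed.

Lemma within_enormP (R : realType) (m : nat) (D : set 'cV[R]_m)
    (x : 'cV[R]_m) (U : set 'cV[R]_m) :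
  within D (nbhs x) U <->
  exists2 d : R, 0 < d & forall y, D y -> enorm (y - x) < d -> U y.
Proof.
apply: (iff_trans (nbhs_enormP x (fun y => D y -> U y))).
by split=> -[d d0 dU]; exists d => // y; move: (dU y); tauto.
Qed.

(** This is the form of continuity that is later transcribed into a first-order formula. *)
Lemma cvg_withinP (R : realType) (n m : nat) (D : set 'cV[R]_n)
    (f : 'cV[R]_n -> 'cV[R]_m) (x : 'cV[R]_n) (l : 'cV[R]_m) :
  (f y @[y --> within D (nbhs x)] --> l) <->
  forall e : R, 0 < e -> exists2 d, 0 < d &
    forall y, D y -> enorm (y - x) < d -> enorm (f y - l) < e.
Proof.
split=> [fl e e0|fl U /nbhs_enormP[e e0 eU]].
  have /fl/within_enormP// : nbhs l (fun z => enorm (z - l) < e).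
  by apply/nbhs_enormP; exists e.
apply/within_enormP; have [d d0 df] := fl e e0.
by exists d => // y Dy /df-/(_ Dy)/eU.
Qed.

(** The ball is open in [Q], so limits along it and along [Q] agree at its points. This passes from
    the balls of the hypothesis to continuity on [Q]. *)
Lemma eball_within (R : realType) (n : nat) (Q : set 'cV[R]_n)
    (x y : 'cV[R]_n) (rho : R) :
  enorm (y - x) < rho -> within (eball Q x rho) (nbhs y) = within Q (nbhs y).
Proof.
move=> yx.
have /nbhs_enormP[d1 d1_gt0 d1x] : nbhs y (fun z => enorm (z - x) < rho).
  by have /cvgr_lt/(_ rho yx) := @enormB_continuous _ _ x y.
apply/funext => U; apply/propext; split=> /within_enormP[d d0 dU];
    apply/within_enormP; last by exists d => // z [Qz _]; exact: dU.
exists (Num.min d d1); first by rewrite lt_min d0.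
move=> z Qz; rewrite lt_min => /andP[zd /d1x zx].
exact: dU.
Qed.

(** Unlike [enorm] it is polynomial, and it orders vectors in the same way. *)
Definition sqnorm (R : realType) (m : nat) (z : 'cV[R]_m) : R :=
  \sum_(i < m) z i 0 ^+ 2.

Lemma enorm_leP (R : realType) (m k : nat) (y : 'cV[R]_m) (z : 'cV[R]_k) :
  (enorm y <= enorm z) = (sqnorm y <= sqnorm z).
Proof.
by rewrite -(ler_pXn2r (n := 2))// ?nnegrE ?enorm_ge0// !sqr_enorm.
Qed.

Lemma sqnorm_ge0 (R : realType) (m : nat) (z : 'cV[R]_m) : 0 <= sqnorm z.
Proof. by apply: sumr_ge0 => i _; rewrite sqr_ge0. Qed.

Lemma sqnormD (R : realType) (m : nat) (y z : 'cV[R]_m) :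
  sqnorm (y + z) = sqnorm y + sqnorm z + (\sum_i y i 0 * z i 0) *+ 2.
Proof.
rewrite /sqnorm -sumrMnl -!big_split/=; apply: eq_bigr => i _.
by rewrite mxE sqrrD addrAC.
Qed.

Definition is_nearest (R : realType) (m : nat) (V : set 'cV[R]_m)
    (w u : 'cV[R]_m) : Prop :=
  V u /\ forall u', V u' -> sqnorm (u - w) <= sqnorm (u' - w).

(** The diagonal entries of [B *m B^T] are the sums of squares of the rows of [B]. *)
Lemma mulmx_tr_eq0 (R : realType) (m n : nat) (B : 'M[R]_(m, n)) :
  B *m B^T = 0 -> B = 0.
Proof.
move=> BB; apply/matrixP => i j; rewrite mxE; apply/eqP; rewrite -sqrf_eq0.
have := congr1 (fun M : 'M[R]_m => M i i) BB; rewrite !mxE => /eqP.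
rewrite psumr_eq0 => [|k _]; last by rewrite mxE -expr2 sqr_ge0.
by move=> /allP/(_ j (mem_index_enum _)); rewrite mxE -expr2.
Qed.

(** Solvability of the normal equations: [A] and [A *m A^T] have the same column space. The proof
    works with the transposed row spaces. *)
Lemma gram_solvable (R : realType) (r s : nat) (A : 'M[R]_(r, s))
    (z : 'cV[R]_s) :
  exists mu : 'cV[R]_r, A *m (A^T *m mu) = A *m z.
Proof.
suff /submxP[mu zmu] : (z^T *m A^T <= A *m A^T)%MS.
  exists mu^T; apply: trmx_inj.
  by rewrite !trmx_mul !trmxK -mulmxA -zmu.
apply: (submx_trans (submxMl _ _)).
(* One inclusion of row spaces is clear, so it suffices to compare ranks, which is done through the
   left kernels. *)
rewrite -(geq_leqif (mxrank_leqif_sup (submxMl A A^T))) mxrank_tr.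
have KA : kermx (A *m A^T) *m A = 0.
  apply: mulmx_tr_eq0; rewrite trmx_mul !mulmxA.
  by rewrite -(mulmxA (kermx _)) mulmx_ker mul0mx.
have /mxrankS : (kermx (A *m A^T) <= kermx A)%MS by apply/sub_kermxP.
by rewrite !mxrank_ker leq_sub2lE ?rank_leq_row.
Qed.

(* The nearest point is [w + A^T mu]; Pythagoras holds because [u' - u] is in the
   kernel of [A]. *)
Lemma nearest_affine (R : realType) (r s : nat) (A : 'M[R]_(r, s))
    (g : 'cV[R]_r) (w : 'cV[R]_s) :
  [set l | A *m l = g] !=set0 ->
  exists u, forall v, is_nearest [set l | A *m l = g] w v <-> v = u.
Proof.
move=> [l Al]; have [mu muE] := gram_solvable A (l - w).
pose u := w + A^T *m mu; exists u.
have Au : A *m u = g by rewrite mulmxDr muE mulmxBr addrC subrK.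
have pyth u' : A *m u' = g -> sqnorm (u' - w) = sqnorm (u - w) + sqnorm (u' - u).
  move=> Au'; have -> : u' - w = (u - w) + (u' - u) by rewrite [RHS]addrC subrKA.
  rewrite sqnormD -[RHS]addr0; congr (_ + _).
  have : ((u - w)^T *m (u' - u)) 0 0 = 0.
    rewrite {1}/u [w + _]addrC addrK trmx_mul trmxK -mulmxA mulmxBr Au' Au.
    by rewrite subrr mulmx0 mxE.
  rewrite mxE => uu.
  suff -> : \sum_i (u - w) i 0 * (u' - u) i 0 = 0 by rewrite mul0rn.
  by rewrite -[RHS]uu; apply: eq_bigr => i _; rewrite !mxE.
move=> v; split=> [[Av /(_ u Au)]|->].
  rewrite (pyth v)// gerDl => vu; apply/eqP; rewrite -subr_eq0.
  by apply/eqP/enorm_eq0/eqP; rewrite sqrtr_eq0.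
by split=> // u' Au'; rewrite (pyth u')// lerDl sqnorm_ge0.
Qed.

(** Existence and uniqueness of the nearest point replace the choice made by [xget] with a
    first-order condition. *)
Lemma eproj_affineP (R : realType) (r s : nat) (A : 'M[R]_(r, s))
    (g : 'cV[R]_r) (w : 'cV[R]_s) :
  [set l | A *m l = g] !=set0 ->
  forall u, u = eproj [set l | A *m l = g] w <->
    is_nearest [set l | A *m l = g] w u.
Proof.
set V := [set l | A *m l = g] => V0.
have nearE v : (V v /\ forall u', V u' -> enorm (v - w) <= enorm (u' - w)) <->
    is_nearest V w v.
  by split=> -[Vv vmin]; split=> // u' /vmin; rewrite enorm_leP.
have [u uP] := nearest_affine w V0.
have -> : eproj V w = u.
  by apply: xget_unique => [|v /nearE/uP//]; apply/nearE/uP.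
by move=> v; split=> [->|/uP//]; apply/uP.
Qed.

(** * Definable constructions and Glaeser refinements *)

Lemma polynomial_fun_sqnorm (R : realType) (m k : nat)
    (f : 'cV[R]_m -> 'cV[R]_k) :
  polynomial_map f -> polynomial_fun (fun x => sqnorm (f x)).
Proof.
by move=> fP; apply: polynomial_fun_sum => i; exact: polynomial_funX.
Qed.

Ltac polynomial := repeat first
  [ exact: polynomial_fun_cst | exact: polynomial_map_cst
  | exact: polynomial_map_id | apply: polynomial_map_usubmx
  | apply: polynomial_map_dsubmx | apply: polynomial_map_col_mx
  | apply: polynomial_mapB | apply: polynomial_mapZ
  | apply: polynomial_funX
  | apply: polynomial_fun_sum => ? | apply: polynomial_funD
  | apply: polynomial_funM | apply: polynomial_fun_sqnorm
  | apply: polynomial_fun_coord ].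

(** A semialgebraic map enters a formula only through its graph, and hence together with the
    condition that the argument lies in its domain. *)
Lemma semialgebraic_graph (R : realType) (n m k : nat) (D : set 'cV[R]_n)
    (f : 'cV[R]_n -> 'cV[R]_m) (a : 'cV[R]_k -> 'cV[R]_n)
    (b : 'cV[R]_k -> 'cV[R]_m) :
  semialgebraic_on D f -> polynomial_map a -> polynomial_map b ->
  semialgebraic (fun z => D (a z) /\ b z = f (a z)).
Proof.
move=> fD aP bP.
apply: semialgebraic_ext (semialgebraic_preimage (polynomial_map_col_mx aP bP) fD).
move=> z; split=> [[x Dx /eq_col_mx[<- <-]]//|[Da ->]].
by exists (a z).
Qed.

Lemma semialgebraic_onP (R : realType) (n m : nat) (D : set 'cV[R]_n)
    (f : 'cV[R]_n -> 'cV[R]_m) :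
  semialgebraic (fun z => D (usubmx z) /\ dsubmx z = f (usubmx z)) ->
  semialgebraic_on D f.
Proof.
apply: semialgebraic_ext => z; split=> [[Dz zf]|[x Dx <-]].
  by exists (usubmx z) => //; rewrite -zf vsubmxK.
by rewrite col_mxKu col_mxKd.
Qed.

(** The domain is a projection of the graph. *)
Lemma semialgebraic_dom (R : realType) (n m : nat) (D : set 'cV[R]_n)
    (f : 'cV[R]_n -> 'cV[R]_m) :
  semialgebraic_on D f -> semialgebraic D.
Proof.
move=> fD.
have := @semialgebraic_exists _ _ _ (fun x y => D x /\ y = f x).
move=> /(_ (semialgebraic_graph fD _ _))-/(_ (polynomial_map_usubmx _) _).
move=> sD; apply: semialgebraic_ext (sD _ _) => [x||]; try by polynomial.
by split=> [[y []]|Dx]//; exists (f x).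
Qed.

(** Squaring is legitimate once [0 < g x] is added, a condition that the inequality implies. *)
Lemma semialgebraic_enorm_lt (R : realType) (m k : nat)
    (f : 'cV[R]_m -> 'cV[R]_k) (g : 'cV[R]_m -> R) :
  polynomial_map f -> polynomial_fun g ->
  semialgebraic (fun x => enorm (f x) < g x).
Proof.
move=> fP gP.
have : semialgebraic (fun x => 0 < g x /\ sqnorm (f x) < g x ^+ 2).
  by apply: semialgebraic_and; apply: semialgebraic_lt; polynomial.
apply: semialgebraic_ext => x; rewrite /sqnorm -sqr_enorm.
have [g0|g0] := ltP 0 (g x).
  rewrite ltr_pXn2r// ?nnegrE ?enorm_ge0// ?ltW//.
  by split=> [[]|].
by split=> [[//]|]; rewrite ltNge (le_trans g0)// enorm_ge0.
Qed.

Lemma semialgebraic_rfun_graph (R : realType) (n k : nat)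
    (f : 'cV[R]_n -> R) (a : 'cV[R]_k -> 'cV[R]_n) (b : 'cV[R]_k -> R) :
  semialgebraic_rfun f -> polynomial_map a -> polynomial_fun b ->
  semialgebraic (fun z => b z = f (a z)).
Proof.
move=> fP aP bP.
have : polynomial_map (fun z => const_mx (b z) : 'cV[R]_1).
  by move=> i; under eq_fun do rewrite mxE.
move=> /(semialgebraic_graph fP aP); apply: semialgebraic_ext => z.
by split=> [[_ /matrixP/(_ 0 0)]|->//]; rewrite !mxE.
Qed.

Lemma semialgebraic_system (R : realType) (n r s : nat)
    (A : 'cV[R]_n -> 'M[R]_(r, s)) (gamma : 'cV[R]_n -> 'cV[R]_r) :
  (forall i j, semialgebraic_rfun (fun x => A x i j)) ->
  (forall i, semialgebraic_rfun (fun x => gamma x i 0)) ->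
  semialgebraic (fun z => system_bundle A gamma (usubmx z) (dsubmx z)).
Proof.
move=> sA sg.
(* The quantified [y] stands for row [i] of [A], whose entries are accessible only through their
   graphs. *)
have sP i : semialgebraic (fun z : 'cV[R]_(n + s) => exists y : 'cV[R]_s,
    (forall j, y j 0 = A (usubmx z) i j) /\
    \sum_j y j 0 * dsubmx z j 0 = gamma (usubmx z) i 0).
  apply: semialgebraic_exists; apply: semialgebraic_and.
    apply: semialgebraic_all => j.
    by apply: (semialgebraic_rfun_graph (sA i j)); polynomial.
  by apply: (semialgebraic_rfun_graph (sg i)); polynomial.
move: (semialgebraic_all sP); apply: semialgebraic_ext => z; split=> [Az|Az i].
  apply/colP => i; have [y [yA <-]] := Az i; rewrite mxE.
  by apply: eq_bigr => j _; rewrite yA.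
exists (\col_j A (usubmx z) i j); split=> [j|]; first by rewrite mxE.
by rewrite -[in RHS]Az mxE; apply: eq_bigr => j _; rewrite mxE.
Qed.

(** Being a nearest point of the fiber is a first-order condition; nonempty fibers make it
    equivalent to being the value of [gamma_proj]. *)
Lemma semialgebraic_gamma_proj (R : realType) (n r s : nat)
    (A : 'cV[R]_n -> 'M[R]_(r, s)) (gamma : 'cV[R]_n -> 'cV[R]_r)
    (D : set 'cV[R]_n) (v : 'cV[R]_s) :
  (forall i j, semialgebraic_rfun (fun x => A x i j)) ->
  (forall i, semialgebraic_rfun (fun x => gamma x i 0)) ->
  semialgebraic D ->
  (forall y, D y -> system_bundle A gamma y !=set0) ->
  semialgebraic_on D (gamma_proj A gamma v).
Proof.
move=> sA sg sD D0; apply: semialgebraic_onP.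
have sys k (a : 'cV[R]_k -> 'cV[R]_n) (b : 'cV[R]_k -> 'cV[R]_s) :
    polynomial_map a -> polynomial_map b ->
    semialgebraic (fun z => system_bundle A gamma (a z) (b z)).
  move=> aP bP; apply: semialgebraic_ext (semialgebraic_preimage
    (polynomial_map_col_mx aP bP) (semialgebraic_system sA sg)) => z.
  by rewrite col_mxKu col_mxKd.
suff : semialgebraic (fun z : 'cV[R]_(n + s) => D (usubmx z) /\
    is_nearest (system_bundle A gamma (usubmx z)) v (dsubmx z)).
  apply: semialgebraic_ext => z.
  by split=> -[Dz]; rewrite (eproj_affineP v (D0 _ Dz)).
apply: semialgebraic_and.
  by apply: semialgebraic_preimage sD; polynomial.
apply: semialgebraic_and; first by apply: sys; polynomial.
apply: semialgebraic_forall; apply: semialgebraic_imply.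
  by apply: sys; polynomial.
by apply: semialgebraic_le; polynomial.
Qed.

(** The failure of the epsilon-delta condition is first-order. In the formula [e] and [d] are
    columns of size 1, to fit the quantifier lemmas, and [g], [h] name the values [f z], [f y]. *)
Lemma semialgebraic_discontinuities (R : realType) (n m : nat)
    (D : set 'cV[R]_n) (f : 'cV[R]_n -> 'cV[R]_m) :
  semialgebraic_on D f -> semialgebraic (discontinuities D f).
Proof.
move=> sf; have sD := semialgebraic_dom sf.
suff : semialgebraic (fun y : 'cV[R]_n => D y /\ ~ forall e : 'cV[R]_1,
    0 < e 0 0 -> exists d : 'cV[R]_1, 0 < d 0 0 /\ forall z, D z ->
    enorm (z - y) < d 0 0 -> exists g, (D z /\ g = f z) /\
    exists h, (D y /\ h = f y) /\ enorm (g - h) < e 0 0).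
  apply: semialgebraic_ext => y.
  split=> -[Dy ny]; split=> //; apply: contra_not ny.
    move=> /cvg_withinP fy e e0; have [d d0 df] := fy _ e0.
    exists (const_mx d); rewrite mxE; split=> // z Dz zd; exists (f z); split=> //.
    by exists (f y); split=> //; exact: df.
  move=> fy; apply/cvg_withinP => e e0.
  have [|d [d0 df]] := fy (const_mx e); first by rewrite mxE.
  exists (d 0 0) => // z Dz zd; have [_ [[_ ->]]] := df z Dz zd.
  by move=> [_ [[_ ->]]]; rewrite mxE.
apply: semialgebraic_and => //; apply: semialgebraic_not.
apply: semialgebraic_forall; apply: semialgebraic_imply.
  by apply: semialgebraic_lt; polynomial.
apply: semialgebraic_exists; apply: semialgebraic_and.
  by apply: semialgebraic_lt; polynomial.
apply: semialgebraic_forall; apply: semialgebraic_imply.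
  by apply: semialgebraic_preimage sD; polynomial.
apply: semialgebraic_imply; first by apply: semialgebraic_enorm_lt; polynomial.
apply: semialgebraic_exists; apply: semialgebraic_and.
  by apply: semialgebraic_graph => //; polynomial.
apply: semialgebraic_exists; apply: semialgebraic_and.
  by apply: semialgebraic_graph => //; polynomial.
by apply: semialgebraic_enorm_lt; polynomial.
Qed.

Lemma edist_set_ge0 (R : realType) (m : nat) (v : 'cV[R]_m) (V : set 'cV[R]_m) :
  (0 <= edist_set v V)%E.
Proof. by apply: le_ereal_inf_tmp => _ [w _ <-]; rewrite lee_fin enorm_ge0. Qed.

(** An infimum below [e] is witnessed by a point of the fiber; in particular, fibers near [x] are
    nonempty. *)
Lemma edist_set_cvg0P (R : realType) (n s : nat) (Q : set 'cV[R]_n)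
    (H : bundle R n s) (x : 'cV[R]_n) (v : 'cV[R]_s) :
  (edist_set v (H y) @[y --> within Q (nbhs x)] --> 0%E) <->
  forall e : R, 0 < e -> exists2 d, 0 < d &
    forall y, Q y -> enorm (y - x) < d -> exists2 w, H y w & enorm (v - w) < e.
Proof.
split=> [Hv e e0|Hv].
  have : nbhs (0%E : \bar R) (fun t => (t < e%:E)%E).
    apply: open_nbhs_nbhs.
    by split; [exact: open_ereal_lt_ereal|rewrite /= lte_fin].
  move=> /Hv/within_enormP[d d0 dH]; exists d => // y Qy yx.
  have /= := dH y Qy yx.
  by move=> /ereal_inf_lt[_ [w Hw <-]]; rewrite lte_fin => vw; exists w.
move=> U U0; apply/within_enormP.
have /nbhs_ballP[e /= e0 eU] : nbhs (0 : R) (fun t => U t%:E) by exact: U0.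
have [d d0 dH] := Hv e e0; exists d => // y Qy /(dH y Qy)[w Hw vw].
have vH : (edist_set v (H y) <= (enorm (v - w))%:E)%E.
  by apply: ereal_inf_lbound; exists w.
have := vw; rewrite -lte_fin => /(le_lt_trans vH).
have := edist_set_ge0 v (H y); case: (edist_set v (H y)) => // t.
rewrite lee_fin lte_fin => t0 te; apply: eU.
by rewrite -ball_normE/= sub0r normrN ger0_norm.
Qed.

Lemma glaeser_iter_sub (R : realType) (n s : nat) (Q : set 'cV[R]_n)
    (H : bundle R n s) (k : nat) (x : 'cV[R]_n) :
  glaeser_iter Q H k x `<=` H x.
Proof. by elim: k x => [|k IH] x v//= [/IH]. Qed.

(** A vector of a refined fiber is approximated by nearby fibers of the bundle one step before,
    which are contained in those of [H]. *)
Lemma glaeser_stable_dist (R : realType) (n s : nat) (Q : set 'cV[R]_n)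
    (H : bundle R n s) (x : 'cV[R]_n) (v : 'cV[R]_s) :
  Q x -> glaeser_stable Q H x v -> H x v /\
  forall e : R, 0 < e -> exists2 d, 0 < d &
    forall y, Q y -> enorm (y - x) < d -> exists2 w, H y w & enorm (v - w) < e.
Proof.
move=> Qx Hv; split; first exact: glaeser_iter_sub Hv.
suff [k [_ /edist_set_cvg0P Hk]] : exists k, glaeser_iter Q H k.+1 x v.
  move=> e /Hk[d d0 dH]; exists d => // y Qy /(dH y Qy)[w Hw vw].
  by exists w => //; exact: glaeser_iter_sub Hw.
(* At a stationary index [k] the fiber equals that of index [k.+1]; the default index 1 is already
   the successor of 0. *)
move: Hv; rewrite /glaeser_stable; case: xgetP => [k _ /(_ x Qx) <-|_] Hv.
  by eexists; exact: Hv.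
by exists 0%N.
Qed.

(** By continuity [phi y] is a point of the fiber at [y] close to [phi x], so [phi] remains a
    section after each refinement. *)
Lemma continuous_section_glaeser (R : realType) (n s : nat) (Q : set 'cV[R]_n)
    (H : bundle R n s) (phi : 'cV[R]_n -> 'cV[R]_s) :
  (forall x, Q x -> H x (phi x)) -> {within Q, continuous phi} ->
  forall x, Q x -> glaeser_stable Q H x (phi x).
Proof.
move=> Hphi /subspace_continuousP cphi x Qx; rewrite /glaeser_stable.
elim: (xget _ _) x Qx => [|k IH] x Qx; first exact: Hphi.
split; first exact: IH.
apply/edist_set_cvg0P => e e0; have /cvg_withinP/(_ e e0)[d d0 df] := cphi x Qx.
exists d => // y Qy yx; exists (phi y); first exact: IH.
by rewrite enormB; exact: df.
Qed.

(** * Isolated points of semialgebraic sets *)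

(** Along the diagonal a polynomial becomes univariate and keeps a constant sign just to the right
    of 0; Boolean operations preserve the dichotomy. *)
Lemma semialgebraic_right_germ (R : realType) (m : nat) (S : set 'cV[R]_m) :
  semialgebraic S -> exists2 e : R, 0 < e &
    (forall t, 0 < t < e -> S (const_mx t)) \/
    (forall t, 0 < t < e -> ~ S (const_mx t)).
Proof.
elim=> [p|T _ [e e0 eT]|T U _ [e e0 eT] _ [d d0 dU]].
- pose q : {poly R} := \sum_(d <- mpoly.msupp p)
    mpoly.mcoeff d p *: \prod_(i < m) 'X^(mpoly.fun_of_multinom d i).
  have qE t : mpoly.meval (fun i => (const_mx t : 'cV[R]_m) i 0) p = q.[t].
    rewrite mpoly.mevalE /q horner_sum; apply: eq_bigr => d _.
    rewrite hornerZ horner_prod; congr (_ * _); apply: eq_bigr => i _.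
    by rewrite hornerXn mxE.
  have [q0|q0] := eqVneq q 0.
    exists 1 => //; right=> t _ /=.
    by rewrite qE q0 horner0 ltxx.
  (* This is the first root of [q] in []0, 1[], or 1 if there is none. *)
  exists (polyrcf.next_root q 0 1); first exact: polyrcf.next_root_gt.
  have qS t : 0 < t < polyrcf.next_root q 0 1 ->
      (0 < q.[t]) = (0 < polyrcf.sgp_right q 0).
    move=> tq; have tN : t \in polyrcf.neighpr q 0 1 by rewrite in_itv.
    by rewrite -sgr_gt0 (polyrcf.sgr_neighpr tN).
  have [s0|s0] := boolP (0 < polyrcf.sgp_right q 0); [left|right] => t /qS tq /=.
    by rewrite qE tq.
  by rewrite qE tq; apply/negP.
- by exists e => //; case: eT => eT; [right=> t /eT Tt nTt|left=> t /eT].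
- exists (Num.min e d); first by rewrite lt_min e0.
  have lt_minP t : 0 < t < Num.min e d -> 0 < t < e /\ 0 < t < d.
    by rewrite lt_min => /and3P[-> -> ->].
  case: eT => [eT|eT]; first by left=> t /lt_minP[/eT]; left.
  case: dU => [dU|dU]; first by left=> t /lt_minP[_ /dU]; right.
  by right=> t /lt_minP[/eT ? /dU ?] [].
Qed.

(** A point is coded by [k] such that coordinate distance [1/(k+1)] isolates it, and by a rational
    point within half of that. Two points with the same code are too close to be distinct. *)
Lemma countable_all_isolated (R : realType) (n : nat) (S : set 'cV[R]_n) :
  S `<=` isolated S -> countable S.
Proof.
move=> Siso.
have code x : exists c : 'cV[rat]_n * nat, S x ->
    (forall i, `|x i 0 - ratr (c.1 i 0)| < c.2.+1%:R^-1 / 2) /\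
    forall y, S y -> (forall i, `|x i 0 - y i 0| < c.2.+1%:R^-1) -> y = x.
  have [Sx|nSx] := pselect (S x); last by exists (0, 0%N).
  have [_ [V /nbhs_ballP[e /= e0 eV] VS]] := Siso x Sx.
  have [k] := ltr_add_invr e0; rewrite add0r => ke.
  have /choice[c cP] : forall i, exists q : rat, `|x i 0 - ratr q| < k.+1%:R^-1 / 2.
    move=> i; have d0 : 0 < k.+1%:R^-1 / 2 :> R by rewrite divr_gt0// invr_gt0.
    have [|q] := @rat_in_itvoo R (x i 0 - k.+1%:R^-1 / 2) (x i 0 + k.+1%:R^-1 / 2).
      by rewrite ltrBlDr -addrA ltrDl addr_gt0.
    by rewrite in_itv/= -ltr_distl distrC => qx; exists q.
  exists (\col_i c i, k) => _; split=> [i|y Sy yx] /=; first by rewrite mxE.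
  suff : (V `&` S) y by rewrite VS.
  split=> //; apply: eV; split=> // i j; rewrite ord1 -ball_normE/=.
  exact: lt_trans (yx i) ke.
have {code} /choice[c cP] := code.
apply/countable_injP; exists (fun x => choice.pickle (c x)) => x y.
rewrite !inE => Sx Sy /(pcan_inj choice.pickleK) cxy.
have [_ xuniq] := cP x Sx; apply/esym; apply: xuniq => // i.
have [xc _] := cP x Sx; have [yc _] := cP y Sy; rewrite -cxy in yc.
have -> : x i 0 - y i 0 = (x i 0 - ratr ((c x).1 i 0)) - (y i 0 - ratr ((c x).1 i 0)).
  by rewrite opprB addrA subrK.
apply: le_lt_trans (ler_normB _ _) _.
by rewrite [X in _ < X]splitr ltrD.
Qed.

(** Countable sets have Lebesgue measure 0, while this interval has measure [e]. *)
Lemma itv_uncountable (R : realType) (e : R) : 0 < e -> ~ countable `]0, e[%classic.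
Proof.
move=> e0 /countable_lebesgue_measure0; rewrite lebesgue_measure_itv/= lte_fin e0.
by rewrite sube0 => -[ee]; move: e0; rewrite ee ltxx.
Qed.

(* The distances from [x] to the points of [S] form a countable semialgebraic set
   of reals, which therefore contains no interval with left end point [0]. *)
Lemma semialgebraic_isolated_gap (R : realType) (n : nat) (S : set 'cV[R]_n)
    (x : 'cV[R]_n) :
  semialgebraic S -> S `<=` isolated S ->
  exists2 e : R, 0 < e & forall y, S y -> enorm (y - x) < e -> y = x.
Proof.
move=> sS /countable_all_isolated cS.
(* The set of distances, with the square root replaced by polynomial conditions. *)
pose T := fun t : 'cV[R]_1 => exists y, S y /\
  (0 <= t 0 0 /\ t 0 0 ^+ 2 = sqnorm (y - x)).
have TE t : T (const_mx t) <-> exists2 y, S y & t = enorm (y - x).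
  rewrite /T mxE; split=> [[y [Sy [t0 ty]]]|[y Sy ->]]; exists y => //.
    by rewrite /enorm -/(sqnorm _) -ty sqrtr_sqr ger0_norm.
  by rewrite enorm_ge0 sqr_enorm.
have sT : semialgebraic T.
  apply: semialgebraic_exists; apply: semialgebraic_and.
    by apply: semialgebraic_preimage sS; polynomial.
  apply: semialgebraic_and; first by apply: semialgebraic_le; polynomial.
  by apply: semialgebraic_eq; polynomial.
have [e e0 [eT|eT]] := semialgebraic_right_germ sT.
  exfalso; apply: (itv_uncountable e0).
  apply: (@sub_countable _ _ _ ((fun y => enorm (y - x)) @` S)); last first.
    exact: sub_countable (card_image_le _ _) cS.
  apply: subset_card_le => t; rewrite /= in_itv/= => /eT/TE[y Sy ->].
  by exists y.
exists e => // y Sy ye; apply/eqP; rewrite -subr_eq0; apply/eqP/enorm_eq0/eqP.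
rewrite eq_le enorm_ge0 andbT leNgt; apply/negP => y0.
by apply: (eT (enorm (y - x))); [rewrite y0|apply/TE; exists y].
Qed.

(** * Gluing local sections *)

Lemma semialgebraic_on_sub (R : realType) (n m : nat) (D D' : set 'cV[R]_n)
    (f : 'cV[R]_n -> 'cV[R]_m) :
  D' `<=` D -> semialgebraic D' -> semialgebraic_on D f ->
  semialgebraic_on D' f.
Proof.
move=> D'D sD' sf; apply: semialgebraic_onP.
have : semialgebraic (fun z : 'cV[R]_(n + m) => D' (usubmx z) /\
    (D (usubmx z) /\ dsubmx z = f (usubmx z))).
  apply: semialgebraic_and; first by apply: semialgebraic_preimage sD'; polynomial.
  by apply: semialgebraic_graph => //; polynomial.
apply: semialgebraic_ext => z; split=> [[? []]|[D'z ->]]//.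
by split=> //; split=> //; exact: D'D.
Qed.

Lemma semialgebraic_on_cst (R : realType) (n m : nat) (D : set 'cV[R]_n)
    (c : 'cV[R]_m) :
  semialgebraic D -> semialgebraic_on D (fun=> c).
Proof.
move=> sD; apply: semialgebraic_onP; apply: semialgebraic_and.
  by apply: semialgebraic_preimage sD; polynomial.
by apply: semialgebraic_eqmap; polynomial.
Qed.

Lemma semialgebraic_onD (R : realType) (n m : nat) (D : set 'cV[R]_n)
    (f g : 'cV[R]_n -> 'cV[R]_m) :
  semialgebraic_on D f -> semialgebraic_on D g ->
  semialgebraic_on D (fun x => f x + g x).
Proof.
move=> sf sg; apply: semialgebraic_onP.
(* Here [u] is the value of [f], and what remains of the sum must be the value of [g]. *)
have : semialgebraic (fun z : 'cV[R]_(n + m) => exists u : 'cV[R]_m,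
    (D (usubmx z) /\ u = f (usubmx z)) /\
    (D (usubmx z) /\ dsubmx z - u = g (usubmx z))).
  apply: semialgebraic_exists; apply: semialgebraic_and.
    by apply: semialgebraic_graph => //; polynomial.
  by apply: semialgebraic_graph => //; polynomial.
apply: semialgebraic_ext => z; split=> [[u [[Dz ->] [_ <-]]]|[Dz ->]].
  by rewrite addrC subrK.
by exists (f (usubmx z)); rewrite addrC addKr.
Qed.

Lemma semialgebraic_on_sum (R : realType) (n m : nat) (D : set 'cV[R]_n)
    (I : eqType) (l : seq I) (f : I -> 'cV[R]_n -> 'cV[R]_m) :
  semialgebraic D -> {in l, forall i, semialgebraic_on D (f i)} ->
  semialgebraic_on D (fun x => \sum_(i <- l) f i x).
Proof.
move=> sD; elim: l => [|i l IH] sf.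
  by under eq_fun do rewrite big_nil; exact: semialgebraic_on_cst.
under eq_fun do rewrite big_cons; apply: semialgebraic_onD.
  by apply: sf; rewrite inE eqxx.
by apply: IH => j jl; apply: sf; rewrite inE jl orbT.
Qed.

(** The unnormalized weight of the partition of unity, positive exactly on the open ball of radius
    [c]. *)
Definition tent (R : realType) (n : nat) (x : 'cV[R]_n) (c : R) (y : 'cV[R]_n) : R :=
  Num.max 0 (c - enorm (y - x)).

Lemma tent_ge0 (R : realType) (n : nat) (x y : 'cV[R]_n) (c : R) :
  0 <= tent x c y.
Proof. by rewrite le_max lexx. Qed.

Lemma tent_gt0 (R : realType) (n : nat) (x y : 'cV[R]_n) (c : R) :
  (0 < tent x c y) = (enorm (y - x) < c).
Proof. by rewrite lt_max ltxx subr_gt0. Qed.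

Lemma tent_eq0 (R : realType) (n : nat) (x y : 'cV[R]_n) (c : R) :
  c <= enorm (y - x) -> tent x c y = 0.
Proof. by move=> cy; rewrite /tent max_l// subr_le0. Qed.

Lemma tent_continuous (R : realType) (n : nat) (x : 'cV[R]_n) (c : R) :
  continuous (tent x c).
Proof.
move=> y; have yc : c - enorm (z - x) @[z --> y] --> c - enorm (y - x).
  exact: (cvgB (cvg_cst _) (@enormB_continuous _ _ x y)).
exact: (@cvg_comp _ _ _ (fun z => (0, c - enorm (z - x)))
  (fun p : R * R => Num.max p.1 p.2) _ _ _ (cvg_pair (cvg_cst 0) yc)
  (@max_continuous _ R (0, c - enorm (y - x)))).
Qed.

Lemma semialgebraic_tent (R : realType) (n k : nat) (x : 'cV[R]_n) (c : R)
    (a : 'cV[R]_k -> 'cV[R]_n) (b : 'cV[R]_k -> R) :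
  polynomial_map a -> polynomial_fun b ->
  semialgebraic (fun z => b z = tent x c (a z)).
Proof.
move=> aP bP.
(* Here [t] is the distance to [x], and the disjunction splits the maximum. *)
have : semialgebraic (fun z : 'cV[R]_(n + 1) => exists t : 'cV[R]_1,
    (0 <= t 0 0 /\ t 0 0 ^+ 2 = sqnorm (usubmx z - x)) /\
    ((t 0 0 < c /\ dsubmx z 0 0 + t 0 0 = c) \/ (c <= t 0 0 /\ dsubmx z 0 0 = 0))).
  apply: semialgebraic_exists; apply: semialgebraic_and.
    apply: semialgebraic_and; first by apply: semialgebraic_le; polynomial.
    by apply: semialgebraic_eq; polynomial.
  apply: semialgebraic_or; apply: semialgebraic_and.
  - by apply: semialgebraic_lt; polynomial.
  - by apply: semialgebraic_eq; polynomial.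
  - by apply: semialgebraic_le; polynomial.
  - by apply: semialgebraic_eq; polynomial.
have abP : polynomial_map (fun z => col_mx (a z) (const_mx (b z) : 'cV[R]_1)).
  by apply: polynomial_map_col_mx => // i; under eq_fun do rewrite mxE.
move=> /(semialgebraic_preimage abP); apply: semialgebraic_ext => z.
rewrite col_mxKu col_mxKd mxE /tent; split=> [[t [[t0 tz]]]|->].
  have -> : enorm (a z - x) = t 0 0.
    by rewrite /enorm -/(sqnorm _) -tz sqrtr_sqr ger0_norm.
  move=> [[tc bc]|[ct ->]]; last by rewrite max_l// subr_le0.
  by rewrite max_r -?bc ?addrK// -(lerD2r (t 0 0)) add0r bc ltW.
exists (const_mx (enorm (a z - x))); rewrite mxE enorm_ge0 sqr_enorm; split=> //.
have [tc|ct] := ltP (enorm (a z - x)) c; [left|right]; split=> //.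
  by rewrite max_r ?subrK// subr_ge0 ltW.
by rewrite max_l// subr_le0.
Qed.

Lemma semialgebraic_eball (R : realType) (n : nat) (Q : set 'cV[R]_n)
    (x : 'cV[R]_n) (r : R) :
  semialgebraic Q -> semialgebraic (eball Q x r).
Proof.
move=> sQ; apply: semialgebraic_and => //.
by apply: semialgebraic_enorm_lt; polynomial.
Qed.

Lemma gamma_proj_nearest (R : realType) (n r s : nat)
    (A : 'cV[R]_n -> 'M[R]_(r, s)) (gamma : 'cV[R]_n -> 'cV[R]_r)
    (v : 'cV[R]_s) (y : 'cV[R]_n) :
  system_bundle A gamma y !=set0 ->
  is_nearest (system_bundle A gamma y) v (gamma_proj A gamma v y).
Proof. by move=> y0; apply/(eproj_affineP v y0). Qed.

(** On a small ball the only possible discontinuity is [x] itself, and there the Glaeser condition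
    gives continuity. *)
Lemma gamma_proj_continuous_near (R : realType) (n r s : nat)
    (Q : set 'cV[R]_n) (A : 'cV[R]_n -> 'M[R]_(r, s))
    (gamma : 'cV[R]_n -> 'cV[R]_r) (x : 'cV[R]_n) (v : 'cV[R]_s) (rho : R) :
  Q x -> semialgebraic_glaeser_stable Q A gamma x v ->
  semialgebraic_radius Q A gamma x v rho ->
  isolated_discontinuities (eball Q x rho) (gamma_proj A gamma v) ->
  exists2 e : R, semialgebraic_radius Q A gamma x v e &
    forall y, eball Q x e y ->
      gamma_proj A gamma v z @[z --> within Q (nbhs y)] --> gamma_proj A gamma v y.
Proof.
move=> Qx [vx _] [rho0 H0 sproj] iso.
have [Hv distv] := glaeser_stable_dist Qx vx.
have xx : enorm (x - x) = 0 by rewrite subrr enorm0.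
have Bx : eball Q x rho x by split=> //; rewrite xx.
have near_v y w : eball Q x rho y -> system_bundle A gamma y w ->
    enorm (gamma_proj A gamma v y - v) <= enorm (w - v).
  by move=> /H0/(gamma_proj_nearest v)[_ +] Hw => /(_ w Hw); rewrite enorm_leP.
(* As [v] lies in the fiber at [x], it is its own nearest point. *)
have projx : gamma_proj A gamma v x = v.
  apply/eqP; rewrite -subr_eq0; apply/eqP/enorm_eq0/eqP.
  by rewrite eq_le enorm_ge0 andbT (le_trans (near_v x v Bx Hv))// subrr enorm0.
(* The nearest point at [y] is at least as close to [v] as the point [w] supplied by the Glaeser
   condition. *)
have contx :
    gamma_proj A gamma v z @[z --> within Q (nbhs x)] --> gamma_proj A gamma v x.
  apply/cvg_withinP => e e0; have [d d0 dH] := distv e e0.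
  exists (Num.min d rho); first by rewrite lt_min d0.
  move=> y Qy; rewrite lt_min => /andP[yd yrho]; have [w Hw vw] := dH y Qy yd.
  rewrite projx; apply: (@le_lt_trans _ _ (enorm (w - v))); first exact: near_v.
  by rewrite enormB.
have [e e0 gap] :=
  semialgebraic_isolated_gap x (semialgebraic_discontinuities sproj) iso.
have eB y : eball Q x (Num.min rho e) y -> eball Q x rho y /\ enorm (y - x) < e.
  by move=> [Qy]; rewrite lt_min => /andP[].
exists (Num.min rho e).
  split; first by rewrite lt_min rho0.
    by move=> y /eB[/H0].
  apply: (semialgebraic_on_sub _ _ sproj); first by move=> y /eB[].
  (* [Q] is not known to be semialgebraic here, but the ball of radius [rho] is, as the domain of a
     semialgebraic map. *)
  have -> : eball Q x (Num.min rho e) = eball (eball Q x rho) x e.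
    apply/funext => y; apply/propext; rewrite /eball/= lt_min; split.
      by move=> [Qy /andP[]].
    by move=> [[Qy ->] ->].
  exact: semialgebraic_eball (semialgebraic_dom sproj).
move=> y /eB[[Qy yrho] ye]; rewrite -(eball_within Q yrho).
apply: contrapT => ny; have yx : y = x by apply: gap => //; split.
by apply: ny; rewrite (eball_within Q yrho) yx.
Qed.

(** Outside the ball nothing is known about [f], but the tent vanishes there, so the graph is
    described in two cases. *)
Lemma semialgebraic_on_tent_scale (R : realType) (n m : nat) (Q : set 'cV[R]_n)
    (x : 'cV[R]_n) (c : R) (f : 'cV[R]_n -> 'cV[R]_m) :
  semialgebraic Q -> semialgebraic_on (eball Q x c) f ->
  semialgebraic_on Q (fun y => tent x c y *: f y).
Proof.
move=> sQ sf; apply: semialgebraic_onP.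
have : semialgebraic (fun z : 'cV[R]_(n + m) => Q (usubmx z) /\
   ((exists u : 'cV[R]_(m + 1), (eball Q x c (usubmx z) /\ usubmx u = f (usubmx z)) /\
      (dsubmx u 0 0 = tent x c (usubmx z) /\ dsubmx z = dsubmx u 0 0 *: usubmx u))
   \/ (~ enorm (usubmx z - x) < c /\ dsubmx z = 0))).
  apply: semialgebraic_and; first by apply: semialgebraic_preimage sQ; polynomial.
  apply: semialgebraic_or.
    apply: semialgebraic_exists; apply: semialgebraic_and.
      by apply: semialgebraic_graph => //; polynomial.
    apply: semialgebraic_and; first by apply: semialgebraic_tent; polynomial.
    by apply: semialgebraic_eqmap; polynomial.
  apply: semialgebraic_and; last by apply: semialgebraic_eqmap; polynomial.
  by apply: semialgebraic_not; apply: semialgebraic_enorm_lt; polynomial.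
apply: semialgebraic_ext => z; split=> -[Qz].
  move=> [[u [[_ uf] [ub ->]]]|[/negP zc ->]]; split=> //; first by rewrite ub uf.
  by rewrite tent_eq0 ?scale0r// leNgt.
move=> ->; split=> //.
have [zc|zc] := pselect (enorm (usubmx z - x) < c); [left|right].
  exists (col_mx (f (usubmx z)) (const_mx (tent x c (usubmx z)))).
  by rewrite col_mxKu col_mxKd mxE.
by split=> //; move/negP: zc; rewrite -leNgt => /tent_eq0->; rewrite scale0r.
Qed.

Lemma semialgebraic_exists_seq (R : realType) (m : nat) (I : eqType)
    (l : seq I) (P : I -> 'cV[R]_m -> Prop) :
  {in l, forall i, semialgebraic (P i)} ->
  semialgebraic (fun x => exists2 i, i \in l & P i x).
Proof.
elim: l => [|i l IH] sP.
  by apply: semialgebraic_ext (@semialgebraic_cst R m False) => x; split=> // -[].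
have sl : {in l, forall j, semialgebraic (P j)}.
  by move=> j jl; apply: sP; rewrite inE jl orbT.
apply: semialgebraic_ext (semialgebraic_or (sP i (mem_head _ _)) (IH sl)) => x.
split=> [[Pi|[j jl Pj]]|[j]].
- by exists i => //; exact: mem_head.
- by exists j => //; rewrite inE jl orbT.
- by rewrite inE => /orP[/eqP->|jl Pj]; [left|right; exists j].
Qed.

Lemma semialgebraic_on_tent (R : realType) (n : nat) (Q : set 'cV[R]_n)
    (x : 'cV[R]_n) (c : R) :
  semialgebraic Q -> semialgebraic_on Q (fun y => const_mx (tent x c y) : 'cV[R]_1).
Proof.
move=> sQ; apply: semialgebraic_onP; apply: semialgebraic_and.
  by apply: semialgebraic_preimage sQ; polynomial.
have : semialgebraic (fun z : 'cV[R]_(n + 1) => dsubmx z 0 0 = tent x c (usubmx z)).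
  by apply: semialgebraic_tent; polynomial.
apply: semialgebraic_ext => z; split=> [zt|->]; last by rewrite mxE.
by apply/colP => i; rewrite ord1 zt mxE.
Qed.

(** The margin [c < d] leaves two cases: [f] is continuous at [y], or the product vanishes on a
    neighbourhood of [y]. *)
Lemma tent_scale_cvg (R : realType) (n m : nat) (Q : set 'cV[R]_n)
    (x y : 'cV[R]_n) (c d : R) (f : 'cV[R]_n -> 'cV[R]_m) :
  c < d ->
  (enorm (y - x) < d -> f z @[z --> within Q (nbhs y)] --> f y) ->
  tent x c z *: f z @[z --> within Q (nbhs y)] --> tent x c y *: f y.
Proof.
move=> cd fy; have ty : tent x c z @[z --> within Q (nbhs y)] --> tent x c y.
  by apply: cvg_trans (@tent_continuous R n x c y); apply: cvg_app; exact: cvg_within.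
have [yd|yd] := ltP (enorm (y - x)) d.
  apply/cvg_colP => i; rewrite mxE; under eq_fun do rewrite mxE.
  by apply: (cvgM ty); have /cvg_colP := fy yd.
have cy := lt_le_trans cd yd.
rewrite (tent_eq0 (ltW cy)) scale0r; apply: cvg_near_cst.
have : \forall z \near nbhs y, c < enorm (z - x).
  by have /cvgr_gt/(_ c cy) := @enormB_continuous _ _ x y.
move=> /nbhs_enormP[e e0 ez]; apply/within_enormP; exists e => // z _ /ez zc.
by rewrite (tent_eq0 (ltW zc)) scale0r.
Qed.

(* The sections [f x], each defined near [x] only, are glued with the partition of
   unity obtained by normalizing the tents centred at the points of a finite
   subcover. *)
Lemma glue_local_sections (R : realType) (n r s : nat) (Q : set 'cV[R]_n)
    (A : 'cV[R]_n -> 'M[R]_(r, s)) (gamma : 'cV[R]_n -> 'cV[R]_r)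
    (rad : 'cV[R]_n -> R) (f : 'cV[R]_n -> 'cV[R]_n -> 'cV[R]_s) :
  compact Q ->
  (forall x, Q x -> [/\ 0 < rad x,
    semialgebraic_on (eball Q x (rad x)) (f x),
    forall y, eball Q x (rad x) y -> A y *m f x y = gamma y &
    forall y, eball Q x (rad x) y -> f x z @[z --> within Q (nbhs y)] --> f x y]) ->
  exists phi : 'cV[R]_n -> 'cV[R]_s,
    [/\ forall x, Q x -> A x *m phi x = gamma x,
        {within Q, continuous phi} &
        semialgebraic_on Q phi].
Proof.
move=> cQ fP; have {}cQ : cover_compact Q by rewrite -compact_cover.
(* Halving the radii provides the margin required by [tent_scale_cvg]. *)
have [|y Qy|l lQ Ql] := cQ _ Q (fun x y => enorm (y - x) < rad x / 2).
- move=> x Qx; rewrite openE => y /= yx.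
  by have /cvgr_lt/(_ _ yx) := @enormB_continuous _ _ x y.
- have [? _ _ _] := fP y Qy.
  by exists y => //=; rewrite subrr enorm0 divr_gt0.
have {}lQ x : x \in l -> Q x by move=> /lQ/set_mem.
pose w x := tent x (rad x / 2).
pose W y := \sum_(x <- l) w x y.
pose phi y := (W y)^-1 *: \sum_(x <- l) w x y *: f x y.
have half x : Q x -> rad x / 2 < rad x.
  by move=> /fP[x0 _ _ _]; rewrite ltr_pdivrMr// ltr_pMr// ltr1n.
have W_gt0 y : Q y -> 0 < W y.
  move=> /Ql[x xl yx]; rewrite /W (big_rem x)//= ltr_pwDl ?tent_gt0//.
  by apply: sumr_ge0 => z _; exact: tent_ge0.
have phi_sol y : Q y -> A y *m phi y = gamma y.
  move=> Qy; rewrite -scalemxAr mulmx_sumr.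
  have -> : \sum_(x <- l) A y *m (w x y *: f x y) = W y *: gamma y.
    rewrite scaler_suml !big_seq; apply: eq_bigr => x xl.
    (* Where the weight is nonzero, [f x] solves the system; elsewhere both terms are 0. *)
    rewrite -scalemxAr; have [yx|/tent_eq0 w0] := ltP (enorm (y - x)) (rad x / 2).
      have [_ _ fx _] := fP x (lQ x xl); rewrite fx//; split=> //.
      exact: lt_trans yx (half x (lQ x xl)).
    by rewrite /w w0 !scale0r.
  by rewrite scalerA mulVf ?scale1r// gt_eqF// W_gt0.
exists phi; split=> //.
  apply/subspace_continuousP => y Qy.
  have Wy : W z @[z --> within Q (nbhs y)] --> W y.
    apply: (@cvg_big _ _ _ _ _ _ _ (within Q (nbhs y)) _ (fun x z => w x z)
      (fun x => w x y)); first exact: add_continuous.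
    move=> x _; apply: cvg_trans (@tent_continuous R n x (rad x / 2) y).
    by apply: cvg_app; exact: cvg_within.
  have Ny : \sum_(x <- l) w x z *: f x z @[z --> within Q (nbhs y)] -->
      \sum_(x <- l) w x y *: f x y.
    rewrite big_seq; under eq_fun do rewrite big_seq.
    apply: (@cvg_big _ _ _ _ _ _ _ (within Q (nbhs y)) _
      (fun x z => w x z *: f x z) (fun x => w x y *: f x y)).
      exact: add_continuous.
    move=> x xl; apply: (tent_scale_cvg (half x (lQ x xl))) => yx.
    by have [_ _ _] := fP x (lQ x xl); apply.
  apply/cvg_colP => i; rewrite mxE; under eq_fun do rewrite mxE.
  apply: cvgM; last by have /cvg_colP := Ny.
  by apply: cvgV => //; rewrite gt_eqF// W_gt0.
(* [Q] is a finite union of balls, each the domain of a semialgebraic section. *)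
have sQ : semialgebraic Q.
  have := @semialgebraic_exists_seq R n _ l (fun x y => eball Q x (rad x) y).
  move=> sE; apply: semialgebraic_ext (sE _) => [y|x /lQ/fP[_ sf _ _]]; last first.
    exact: semialgebraic_dom sf.
  split=> [[x _ []]//|Qy]; have [x xl yx] := Ql y Qy; exists x => //.
  by split=> //; apply: lt_trans yx (half x (lQ x xl)).
have sW : semialgebraic_on Q (fun y => const_mx (W y) : 'cV[R]_1).
  have -> : (fun y => const_mx (W y) : 'cV[R]_1) =
      fun y => \sum_(x <- l) (const_mx (w x y) : 'cV[R]_1).
    apply/funext => y; apply/colP => i; rewrite mxE summxE.
    by apply: eq_bigr => x _; rewrite mxE.
  by apply: semialgebraic_on_sum => // x _; exact: semialgebraic_on_tent.
have sN : semialgebraic_on Q (fun y => \sum_(x <- l) w x y *: f x y).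
  apply: semialgebraic_on_sum => // x /lQ Qx.
  apply: semialgebraic_on_tent_scale => //.
  have [_ sf _ _] := fP x Qx; apply: (semialgebraic_on_sub _ _ sf).
    by move=> y [Qy yx]; split=> //; exact: lt_trans yx (half x Qx).
  exact: semialgebraic_eball.
apply: semialgebraic_onP.
(* The column [u] stacks the numerator and the denominator [W]; the quotient is expressed by a
   multiplication. *)
have : semialgebraic (fun z : 'cV[R]_(n + s) => exists u : 'cV[R]_(s + 1),
    (Q (usubmx z) /\ dsubmx u = const_mx (W (usubmx z))) /\
    ((Q (usubmx z) /\ usubmx u = \sum_(x <- l) w x (usubmx z) *: f x (usubmx z)) /\
     dsubmx u 0 0 *: dsubmx z = usubmx u)).
  apply: semialgebraic_exists; apply: semialgebraic_and.
    by apply: semialgebraic_graph sW _ _; polynomial.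
  apply: semialgebraic_and; first by apply: semialgebraic_graph sN _ _; polynomial.
  by apply: semialgebraic_eqmap; polynomial.
apply: semialgebraic_ext => z; split=> [[u [[Qz uW] [[_ uN] zE]]]|[Qz zE]].
  split=> //; rewrite /phi -uN -zE uW mxE scalerA mulVf ?scale1r// gt_eqF//.
  exact: W_gt0.
exists (col_mx (W (usubmx z) *: dsubmx z) (const_mx (W (usubmx z)))).
rewrite col_mxKu col_mxKd mxE; split=> //; split=> //; split=> //.
by rewrite zE scalerA mulfV ?scale1r// gt_eqF// W_gt0.
Qed.

(** * Solvability in terms of the fibers *)

Unset Implicit Arguments.
Set Strict Implicit.

Theorem theorem3p1 (R : realType) (n r s : nat) (Q : set 'cV[R]_n)
    (A : 'cV[R]_n -> 'M[R]_(r, s)) (gamma : 'cV[R]_n -> 'cV[R]_r)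
    (Q_compact : compact Q)
    (A_semialgebraic :
       forall i j, semialgebraic_rfun (fun x => A x i j))
    (gamma_semialgebraic :
       forall i, semialgebraic_rfun (fun x => gamma x i 0))
    (isolated_hyp : forall x, Q x ->
       semialgebraic_glaeser_stable Q A gamma x !=set0 ->
       exists (v : 'cV[R]_s) (rho : R),
         [/\ semialgebraic_glaeser_stable Q A gamma x v,
             semialgebraic_radius Q A gamma x v rho &
             isolated_discontinuities (eball Q x rho) (gamma_proj A gamma v)]) :
  (exists phi : 'cV[R]_n -> 'cV[R]_s,
     [/\ forall x, Q x -> A x *m phi x = gamma x,
         {within Q, continuous phi} &
         semialgebraic_on Q phi])
  <-> (forall x, Q x -> semialgebraic_glaeser_stable Q A gamma x !=set0).
Proof.
split=> [[phi [phi_sol phi_cont phi_sa]] x Qx|H0].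
  exists (phi x); split.
    exact: continuous_section_glaeser phi_sol phi_cont x Qx.
  have Hball y : eball Q x 1 y -> system_bundle A gamma y !=set0.
    by move=> [Qy _]; exists (phi y); exact: phi_sol.
  (* Any radius would do, since [phi] makes every fiber over [Q] nonempty; [Q] is semialgebraic as
     the domain of [phi]. *)
  exists 1; split=> //; apply: semialgebraic_gamma_proj => //.
  exact: semialgebraic_eball (semialgebraic_dom phi_sa).
(* Select a vector and a radius at every point of [Q] simultaneously; outside [Q] the pair is a
   dummy. *)
have /choice[c cP] : forall x, exists c : 'cV[R]_s * R, Q x ->
    semialgebraic_radius Q A gamma x c.1 c.2 /\
    forall y, eball Q x c.2 y -> gamma_proj A gamma c.1 z
      @[z --> within Q (nbhs y)] --> gamma_proj A gamma c.1 y.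
  move=> x; have [Qx|nQx] := pselect (Q x); last by exists (0, 0).
  have [v [rho [vx vrho iso]]] := isolated_hyp x Qx (H0 x Qx).
  have [e ve cont] := gamma_proj_continuous_near Qx vx vrho iso.
  by exists (v, e).
apply: (glue_local_sections (rad := fun x => (c x).2)
  (f := fun x => gamma_proj A gamma (c x).1)) => // x /cP[[e0 Hball sproj] cont].
by split=> // y /Hball/(gamma_proj_nearest (c x).1)[].
Qed.
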